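(* Let $E$ be a Banach space (with norm $\|\cdot\|$) of analytic functions on the unit disc $\mathbb D$ in which the polynomials are dense and the point evaluations are continuous. Assume that there exists $f\in E$ such that $$\Big|\Big\{e^{i\theta}\in\mathbb T:\limsup_{r\to 1}|f(re^{i\theta})|=\infty\Big\}\Big|=1.$$ Then the set $$\Big\{g\in E:\ \Big|\Big\{e^{i\theta}\in\mathbb T:\limsup_{r\to 1}|g(re^{i\theta})|=\infty\Big\}\Big|=1\Big\}$$ is a residual set in $E$.
   Context: $\mathbb D=\{z\in\mathbb C:|z|<1\}$ and $\mathbb T$ is the unit circle. For a Lebesgue measurable set $F\subset\mathbb T$, $|F|$ denotes its normalized Lebesgue measure ($dm(\theta)=\frac{1}{2\pi}d\theta$, so $|\mathbb T|=1$). $E$ is a complex vector space of analytic functions on $\mathbb D$, complete under $\|\cdot\|$. ''The polynomials are dense'' means that $E$ contains all (complex) polynomials and they form a dense subset of $E$. ''The point evaluations are continuous'' means that for every $z\in\mathbb D$ the linear functional $h\mapsto h(z)$ is continuous on $E$. Limits $r\to1$ are taken with $0\le r<1$. A residual set is a set containing a dense $G_\delta$ set, a $G_\delta$ set being a countable intersection of open sets. *)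

(* Defs.v *)
From HB Require Import structures.
From mathcomp Require Import all_boot all_order all_algebra.
From mathcomp Require Import complex.
From mathcomp Require Import all_classical all_reals all_analysis.
From mathcomp Require Import borel_hierarchy.

Set Implicit Arguments.
Unset Strict Implicit.
Unset Printing Implicit Defensive.

Import Order.TTheory GRing.Theory Num.Theory.
Import numFieldNormedType.Exports.

Local Open Scope classical_set_scope.
Local Open Scope ring_scope.
Local Open Scope complex_scope.

Section Disc.
Context {R : realType}.
Implicit Types (f : R[i] -> R[i]) (z w : R[i]) (F : set R[i]).

(* The order of R[i] compares only complex numbers with equal imaginary parts,
   and `|z| is the modulus of z embedded in R[i], so these are the usual sets. *)
Definition unit_disc : set R[i] := [set z | `|z| < 1].

Definition unit_circle : set R[i] := [set z | `|z| = 1].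

Definition expi (t : R) : R[i] := cos t +i* sin t.

(* Complex differentiability: R[i]^o is R[i] as a normed space over itself. *)
Definition analytic_on_disc f : Prop :=
  forall z, unit_disc z -> derivable (f : R[i]^o -> R[i]^o) z 1.

Definition circle_measure F : \bar R :=
  (((2 * pi)^-1)%:E *
   completed_lebesgue_measure [set t : R | (0 <= t < 2 * pi)%R /\ F (expi t)])%E.

(* Only 0 <= r < 1 matters for the filter 1^'-, so only the values of f on the
   disc are used. *)
Definition radial_limsup f w : \bar R :=
  limf_esup (fun r : R => (complex.Re `|f (r%:C * w)|)%:E) (1 : R)^'-.

Definition radially_unbounded_set f : set R[i] :=
  [set w | unit_circle w /\ radial_limsup f w = +oo%E].

End Disc.

(* A vector space E of analytic functions on the disc is given by the
   values ev h z of its elements h at the points z of the disc; what ev h does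
   outside the disc is irrelevant. *)
Record analytic_function_space (R : realType) (E : lmodType R[i])
    (ev : E -> R[i] -> R[i]) : Prop := AnalyticFunctionSpace {
  ev_linear : forall (a : R[i]) (g h : E) z, unit_disc z ->
    ev (a *: g + h) z = a * ev g z + ev h z;
  ev_inj : forall g h : E, (forall z, unit_disc z -> ev g z = ev h z) -> g = h;
  ev_analytic : forall h : E, analytic_on_disc (ev h)
}.

Definition represents_poly (R : realType) (E : Type) (ev : E -> R[i] -> R[i])
    (h : E) (p : {poly R[i]}) : Prop :=
  forall z, unit_disc z -> ev h z = p.[z].

Definition polynomials_dense (R : realType) (E : normedModType R[i])
    (ev : E -> R[i] -> R[i]) : Prop :=
  (forall p : {poly R[i]}, exists h : E, represents_poly ev h p) /\
  dense [set h : E | exists p : {poly R[i]}, represents_poly ev h p].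

Definition point_evaluations_continuous (R : realType) (E : normedModType R[i])
    (ev : E -> R[i] -> R[i]) : Prop :=
  forall z, unit_disc z -> continuous (fun h : E => ev h z : R[i]^o).

Definition residual (T : topologicalType) (A : set T) : Prop :=
  exists G : set T, [/\ Gdelta G, dense G & G `<=` A].

(* Main.v *)
(* For n in N, let A_n(g) be the set of angles t in [0, 2 pi) such that
   |g(r e^{it})| > n for some r in (1 - 1/(n+1), 1).  These sets decrease to the
   set of angles where the radial limsup of g is infinite, so the latter has
   full measure iff |A_n(g)| > 2 pi - 1/(n+1) for all n.  By Fatou's lemma and
   the continuity of point evaluations, g |-> |A_n(g)| is lower semicontinuous,
   so the set of the theorem is itself a G_delta.  It contains a f + p for every
   polynomial p and a <> 0, because p is bounded on the disc; hence it is dense.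
   Baire's theorem is not needed. *)
Require Import Defs.
From HB Require Import structures.
From mathcomp Require Import all_boot all_order all_algebra.
From mathcomp Require Import complex.
From mathcomp Require Import all_classical all_reals all_analysis.
From mathcomp Require Import borel_hierarchy.

Set Implicit Arguments.
Unset Strict Implicit.

Import Order.TTheory GRing.Theory Num.Theory.
Import numFieldNormedType.Exports.

Local Open Scope classical_set_scope.
Local Open Scope ring_scope.

Section Disc.
Local Open Scope complex_scope.
Context {R : realType}.
Implicit Types (z : R[i]) (f : R[i] -> R[i]).

(** * Modulus, circle parametrization and polynomial bounds over [R[i]] *)

Lemma complex_normE z : `|z| = (complex.Re `|z|)%:C.
Proof. by case: z. Qed.

Lemma ltr_nat_Re_norm (n : nat) z :
  (n%:R < complex.Re `|z|) = (n%:R < `|z|).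
Proof. by rewrite [in RHS]complex_normE -(rmorph_nat (real_complex R)) ltcR. Qed.

Lemma gt0_complexP (e : R[i]) : 0 < e -> exists2 d : R, 0 < d & e = d%:C.
Proof.
move=> e0; have ed : (complex.Re e)%:C = e by rewrite RRe_real// gtr0_real.
by exists (complex.Re e); rewrite // -ltcR ed.
Qed.

Lemma complex_archimedean z : z \is Num.real -> exists n : nat, z < n%:R.
Proof.
move=> /RRe_real <-; exists (Num.bound `|complex.Re z|).
rewrite -(rmorph_nat (real_complex R)) ltcR.
exact: le_lt_trans (ler_norm _) (archi_boundP (normr_ge0 _)).
Qed.

Lemma norm_real_complex (x : R) : `|x%:C| = `|x|%:C.
Proof. by rewrite normc_def /= expr0n /= addr0 sqrtr_sqr. Qed.

Lemma continuous_real_complex : continuous (real_complex R : R -> R[i]^o).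
Proof.
move=> x; apply/cvgrPdist_lt => _ /gt0_complexP[e e0 ->].
near=> y; rewrite -rmorphB norm_real_complex ltcR; near: y.
exact: cvgr_dist_lt.
Unshelve. all: by end_near. Qed.

Lemma norm_expi (t : R) : `|expi t| = 1.
Proof. by rewrite normc_def /= cos2Dsin2 sqrtr1. Qed.

Lemma continuous_expi : continuous (expi : R -> R[i]^o).
Proof.
have -> : expi = (fun t => (cos t)%:C + (sin t)%:C * 'i%C) :> (R -> R[i]^o).
  by apply/funext => t; rewrite mulrC [LHS]complexE.
move=> t; apply: (@cvgD _ R[i]^o); last apply: cvgMr_tmp.
- apply: (@continuous_comp _ _ _ cos (real_complex R : R -> R[i]^o)).
    exact: continuous_cos.
  exact: continuous_real_complex.
- apply: (@continuous_comp _ _ _ sin (real_complex R : R -> R[i]^o)).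
    exact: continuous_sin.
  exact: continuous_real_complex.
Qed.

Lemma analytic_circle_continuous f (r : R) : analytic_on_disc f ->
  0 <= r < 1 -> continuous (fun t => f (r%:C * expi t) : R[i]^o).
Proof.
move=> fan /andP[r0 r1] t.
apply: (@continuous_comp R R[i]^o R[i]^o (fun t => r%:C * expi t) f).
  by apply: cvgMl_tmp; exact: continuous_expi.
apply/differentiable_continuous/derivable1_diffP/fan.
by rewrite /unit_disc/= normrM norm_real_complex norm_expi mulr1 ger0_norm// ltcR.
Qed.

(** Powers of [z] have modulus at most 1 on the disc, so the sum of the moduli of the coefficients
    bounds [p]. *)
Lemma polynomial_bounded_on_disc (p : {poly R[i]}) :
  exists n : nat, forall z, unit_disc z -> `|p.[z]| < n%:R.
Proof.
have [|n np] := @complex_archimedean (\sum_(i < size p) `|p`_i|).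
  by apply: ger0_real; apply: sumr_ge0.
exists n => z z1; apply: le_lt_trans np; rewrite horner_coef.
apply: le_trans (ler_norm_sum _ _ _) _; apply: ler_sum => i _.
by rewrite normrM normrX ler_piMr// exprn_ile1// ltW.
Qed.

(** * Radial limsup and large angles *)

Definition angles : set R := `[0, 2 * pi[%classic.

(** A single [n] controls both the closeness of [r] to 1 and the size of the value, which turns the
    limsup into a countable intersection. *)
Lemma radial_limsup_eqyP f z : radial_limsup f z = +oo%E <->
  forall n : nat, exists r : R,
    1 - n.+1%:R^-1 < r < 1 /\ n%:R < `|f (r%:C * z)|.
Proof.
(* The infimum over neighbourhoods is [+oo] exactly when the supremum over each one is. *)
rewrite /radial_limsup /limf_esup ereal_inf_pinfty; split => [fy n|fy _ [V V1 <-] /=].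
  have /fy /= supy : [set ereal_sup [set (complex.Re `|f (r%:C * z)|)%:E | r in V]
      | V in (1 : R)^'-] (ereal_sup [set (complex.Re `|f (r%:C * z)|)%:E
      | r in [set r : R | 1 - n.+1%:R^-1 < r < 1]]).
    exists [set r : R | 1 - n.+1%:R^-1 < r < 1] => //.
    near=> r; apply/andP; split; near: r.
      by apply: nbhs_left_gt; rewrite ltrBlDr ltrDl invr_gt0.
    exact: nbhs_left_lt.
  have : (n%:R%:E < ereal_sup [set (complex.Re `|f (r%:C * z)|)%:E
      | r in [set r : R | (1 - n.+1%:R^-1 < r < 1)%R]])%E by rewrite supy ltry.
  move=> /ereal_sup_gt [_ [r r1 <-]]; rewrite lte_fin ltr_nat_Re_norm => nr.
  by exists r.
apply/eqyP => A _.
move: V1 => /nbhs_ballP [e /= e0 eV].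
have [k] := ltr_add_invr e0; rewrite add0r => ke.
(* The index [k] puts [r] within [e] of 1; [Num.bound] pushes the value above [A]. *)
have [r [/andP[nr r1] Ar]] := fy (maxn k (Num.bound `|A|)).
have Vr : V r.
  apply: eV => //=; rewrite /ball/= ger0_norm ?subr_ge0 1?ltW//.
  rewrite ltrBlDr -ltrBlDl; apply: le_lt_trans nr.
  rewrite lerD2l lerN2; apply: le_trans (ltW ke).
  by rewrite lef_pV2 ?posrE// ler_nat ltnS leq_maxl.
apply: le_trans (ereal_sup_ubound _); last by exists r; [exact: Vr|].
rewrite lee_fin; apply: le_trans (ler_norm _) _; apply: ltW.
apply: lt_trans (archi_boundP (normr_ge0 _)) _.
by apply: le_lt_trans (_ : _ <= (maxn k (Num.bound `|A|))%:R) _;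
  rewrite ?ltr_nat_Re_norm// ler_nat leq_maxr.
Unshelve. all: by end_near. Qed.

(** This is [A_n] before restriction to one period, left on the whole line so that it is open. *)
Definition large_angles f (n : nat) : set R :=
  [set t | exists r : R,
    1 - n.+1%:R^-1 < r < 1 /\ n%:R < `|f (r%:C * expi t)|].

(** Keeps the witness points in the disc; the shift to [n.+1] makes the subtracted inverse at most
    1. *)
Lemma radius_ge0 (n : nat) (r : R) : 1 - n.+1%:R^-1 < r -> 0 <= r.
Proof.
move=> /ltW; apply: le_trans.
by rewrite subr_ge0 invf_le1// ler1n.
Qed.

(** A union over radii of open sets, since [f] is continuous along each circle of radius [r < 1].
    Measurability follows. *)
Lemma open_large_angles f n : analytic_on_disc f -> open (large_angles f n).
Proof.
move=> fan.
have -> : large_angles f n = \bigcup_(r in [set r : R | 1 - n.+1%:R^-1 < r < 1])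
    [set t | n%:R < `|f (r%:C * expi t)|].
  by apply/seteqP; split=> [t [r [r1 nr]]|t [r r1 nr]]; exists r.
apply: bigcup_open => r /= /andP[nr r1]; rewrite openE => t /= nt.
have r01 : 0 <= r < 1 by rewrite (radius_ge0 nr).
exact: (cvgr_norm_gt (V := R[i]^o) _ (@analytic_circle_continuous f r fan r01 t)).
Qed.

Lemma large_anglesS f n m : (n <= m)%N -> large_angles f m `<=` large_angles f n.
Proof.
move=> nm t [r [/andP[mr r1] fr]]; exists r; split.
  rewrite r1 andbT; apply: le_lt_trans mr.
  by rewrite lerD2l lerN2 lef_pV2 ?posrE// ler_nat ltnS.
by apply: le_lt_trans fr; rewrite ler_nat.
Qed.

Lemma radially_unbounded_anglesE f :
  [set t : R | (0 <= t < 2 * pi)%R /\ radially_unbounded_set f (expi t)] =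
  \bigcap_n (angles `&` large_angles f n).
Proof.
apply/seteqP; split=> [t [t2 [_ /radial_limsup_eqyP ft]] n _|t ft].
  by split; [rewrite /angles/= in_itv|exact: ft].
split; first by have [] := ft 0%N I; rewrite /angles/= in_itv.
split; first exact: norm_expi.
by apply/radial_limsup_eqyP => n; have [] := ft n I.
Qed.

(** * Measure of the sets of large angles *)

Let mu := @lebesgue_measure R.

Lemma lebesgue_measureS A B : measurable A -> measurable B -> A `<=` B ->
  (mu A <= mu B)%E.
Proof. by move=> mA mB AB; apply: le_measure; rewrite ?inE. Qed.

Lemma measurable_angles (f : R[i] -> R[i]) n : analytic_on_disc f ->
  measurable (angles `&` large_angles f n).
Proof.
move=> fan; apply: measurableI; first exact: measurable_itv.
by apply: measurable_realfun.open_measurable; exact: open_large_angles.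
Qed.

Lemma lebesgue_measure_angles : mu angles = (2 * pi)%:E.
Proof.
by rewrite /mu /angles lebesgue_measure_itv/= lte_fin mulr_gt0 ?pi_gt0// oppr0 adde0.
Qed.

Lemma measure_angles_le A : measurable A -> (mu (angles `&` A) <= (2 * pi)%:E)%E.
Proof.
move=> mA; rewrite -lebesgue_measure_angles.
apply: lebesgue_measureS; [|exact: measurable_itv|exact: subIsetl].
by apply: measurableI => //; exact: measurable_itv.
Qed.

Lemma measurable_unbounded_angles f : analytic_on_disc f ->
  measurable (\bigcap_n (angles `&` large_angles f n)).
Proof. by move=> fan; apply: bigcapT_measurable => n; exact: measurable_angles. Qed.

Lemma circle_measure_eq1E f : circle_measure (radially_unbounded_set f) = 1%E <->
  mu (\bigcap_n (angles `&` large_angles f n)) = (2 * pi)%:E.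
Proof.
have pi2 : 0 < 2 * pi :> R by rewrite mulr_gt0// pi_gt0.
rewrite /circle_measure radially_unbounded_anglesE.
(* The completed measure is convertible to [mu] as a set function; only the sigma-algebra
   differs. *)
rewrite -[completed_lebesgue_measure _]/(mu _); set M := mu _.
split=> [h|->]; last by rewrite -EFinM mulVf ?gt_eqF.
by rewrite -[RHS]mule1 -h muleA -EFinM divff ?gt_eqF// mul1e.
Qed.

Lemma circle_measure_eq1S f g : analytic_on_disc f -> analytic_on_disc g ->
  radially_unbounded_set f `<=` radially_unbounded_set g ->
  circle_measure (radially_unbounded_set f) = 1%E ->
  circle_measure (radially_unbounded_set g) = 1%E.
Proof.
move=> fan gan fg; rewrite !circle_measure_eq1E => f1.
have mf := measurable_unbounded_angles fan.
have mg := measurable_unbounded_angles gan.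
apply/eqP; rewrite eq_le -{1}lebesgue_measure_angles -f1.
apply/andP; split.
  apply: lebesgue_measureS => //; first exact: measurable_itv.
  by move=> t /(_ 0%N I)[].
apply: lebesgue_measureS => //.
by rewrite -!radially_unbounded_anglesE => t [t2 /fg].
Qed.

(** Strict bounds replace equality with [2 * pi] because semicontinuity turns them into open
    conditions. They suffice: the sets decrease, so each one contains sets of arbitrarily small
    deficit and has full measure, and continuity from above passes to the intersection. *)
Lemma circle_measure_eq1P f : analytic_on_disc f ->
  circle_measure (radially_unbounded_set f) = 1%E <->
  forall n, ((2 * pi - n.+1%:R^-1)%:E < mu (angles `&` large_angles f n))%E.
Proof.
move=> fan; rewrite circle_measure_eq1E; set M := mu _.
have mf n := measurable_angles n fan.
have mbig := measurable_unbounded_angles fan.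
split=> [Mpi n|fn].
  apply: (@lt_le_trans _ _ M).
    by rewrite Mpi lte_fin ltrBlDr ltrDl invr_gt0.
  by apply: lebesgue_measureS mbig (mf n) _; exact: bigcap_inf.
have fpi n : mu (angles `&` large_angles f n) = (2 * pi)%:E.
  apply/eqP; rewrite eq_le measure_angles_le/=; last first.
    by apply: measurable_realfun.open_measurable; exact: open_large_angles.
  apply/lee_addgt0Pr => e e0.
  have [k] := ltr_add_invr e0; rewrite add0r => ke.
  rewrite -leeBlDr//.
  apply: (@le_trans _ _ (mu (angles `&` large_angles f (maxn n k)))).
    apply/ltW/(le_lt_trans _ (fn (maxn n k))).
    rewrite -EFinB lee_fin lerD2l lerN2; apply: le_trans (ltW ke).
    by rewrite lef_pV2 ?posrE// ler_nat ltnS leq_maxr.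
  apply: lebesgue_measureS (mf _) (mf _) _.
  by apply: setIS; apply: large_anglesS; exact: leq_maxl.
have cvM : mu (angles `&` large_angles f n) @[n --> \oo] --> M.
  apply: nonincreasing_cvg_mu => //.
    by apply: (@le_lt_trans _ _ (2 * pi)%:E); [rewrite -(fpi 0%N)|exact: ltry].
  by move=> n m nm; apply/subsetPset; apply: setIS; exact: large_anglesS.
apply/eqP; rewrite eq_le; apply/andP; split.
- by apply: (cvge_to_le cvM); apply: nearW => n; rewrite fpi.
- by apply: (cvge_to_ge cvM); apply: nearW => n; rewrite fpi.
Qed.

(* Fatou's lemma: pointwise convergence suffices, because a radius witnessing
   that an angle is large for g is eventually a witness for h j as well. *)
Lemma measure_large_angles_le (g : R[i] -> R[i]) (h : nat -> R[i] -> R[i]) n c :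
  analytic_on_disc g -> (forall j, analytic_on_disc (h j)) ->
  (forall z, unit_disc z -> (h j z : R[i]^o) @[j --> \oo] --> (g z : R[i]^o)) ->
  (forall j, (mu (angles `&` large_angles (h j) n) <= c)%E) ->
  (mu (angles `&` large_angles g n) <= c)%E.
Proof.
move=> gan han hg hc.
(* The union of the increasing sets [B j] is the set-theoretic liminf of the large angles of the
   [h i]. *)
pose B j := \bigcap_(i in [set i | (j <= i)%N]) (angles `&` large_angles (h i) n).
have mB j : measurable (B j).
  apply: bigcap_measurable; first by exists j; rewrite /= leqnn.
  by move=> i _; exact: measurable_angles (han i).
have mUB : measurable (\bigcup_j B j) by exact: bigcupT_measurable.
apply: (@le_trans _ _ (mu (\bigcup_j B j))).
  apply: (lebesgue_measureS (measurable_angles n gan) mUB).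
  move=> t [t2 [r [/andP[nr r1] gr]]].
  have : unit_disc (r%:C * expi t).
    rewrite /unit_disc/= normrM norm_real_complex norm_expi mulr1.
    by rewrite ger0_norm ?(radius_ge0 nr)// ltcR.
  move=> /hg /cvgr_norm_gt /(_ _ gr) [N _ Nh].
  exists N => // i /= Ni; split=> //; exists r; split; first by rewrite nr.
  exact: Nh.
have : mu (B j) @[j --> \oo] --> mu (\bigcup_j B j).
  apply: nondecreasing_cvg_mu => // i j ij; apply/subsetPset => t Bt k /= jk.
  by apply: Bt => /=; exact: leq_trans jk.
move=> /cvge_to_le; apply; near=> j.
apply: le_trans (hc j); apply: (lebesgue_measureS (mB j) (measurable_angles n (han j))).
by apply: bigcap_inf => /=.
Unshelve. all: by end_near. Qed.

End Disc.

(** * Semicontinuity and perturbation in [E] *)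

Section FunctionSpace.
Local Open Scope complex_scope.
Context {R : realType} {E : normedModType R[i]} {ev : E -> R[i] -> R[i]}
  (E_functions : analytic_function_space ev).

(** If [g] were not interior, balls of radius [j.+1%:R^-1] would give a sequence outside the set
    converging to [g] in norm, hence pointwise on the disc, against Fatou's lemma. *)
Lemma open_measure_large_angles n (c : \bar R) :
  point_evaluations_continuous ev ->
  open [set g : E | (c < lebesgue_measure (angles `&` large_angles (ev g) n))%E].
Proof.
move=> ev_cont; rewrite openE => g /= cg; apply: contrapT => gO.
have h_ j : exists h : E, ball g (j.+1%:R^-1 : R[i]) h /\
    ~ (c < lebesgue_measure (angles `&` large_angles (ev h) n))%E.
  apply: contrapT => nh; apply: gO; apply/nbhs_ballP.
  exists j.+1%:R^-1 => /=; first by rewrite invr_gt0 ltr0n.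
  by move=> h gh /=; apply: contrapT => hc; apply: nh; exists h.
have [h hP] := choice h_.
have hg : h j @[j --> \oo] --> g.
  apply/cvgrPdist_lt => e e0.
  have [N] := complex_archimedean (ger0_real (ltW (etrans (invr_gt0 e) e0))).
  move=> eN; exists N => // j /= Nj.
  have [+ _] := hP j; rewrite -ball_normE/= => /lt_trans; apply.
  rewrite invf_plt ?posrE ?ltr0n//; apply: lt_le_trans eN _.
  by rewrite ler_nat leqW.
suff : (lebesgue_measure (angles `&` large_angles (ev g) n) <= c)%E.
  by rewrite leNgt cg.
apply: (@measure_large_angles_le _ (ev g) (fun j => ev (h j))).
- exact: ev_analytic.
- by move=> j; exact: ev_analytic.
- by move=> z z1; apply: (continuous_cvg _ (ev_cont z z1 g) hg).
- by move=> j; have [_ /negP] := hP j; rewrite -leNgt.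
Qed.

Lemma radially_unbounded_add_poly (f h : E) (p : {poly R[i]}) (a : R[i]) :
  a != 0 -> represents_poly ev h p ->
  radially_unbounded_set (ev f) `<=` radially_unbounded_set (ev (a *: f + h)).
Proof.
move=> a0 hp w [w1 /radial_limsup_eqyP fw]; split => //.
apply/radial_limsup_eqyP => n.
have [C pC] := polynomial_bounded_on_disc p.
have na0 : 0 < `|a| by rewrite normr_gt0.
(* Once [|f|] exceeds [(n + C) / |a|], the reverse triangle inequality gives
   [|a f + p| >= |a| |f| - |p| > n]. *)
have [N NC] : exists N : nat, (n%:R + C%:R) / `|a| < N%:R :> R[i].
  by apply/complex_archimedean/ger0_real/divr_ge0.
have [r [/andP[nr r1] fr]] := fw (maxn n N).
exists r; split.
  rewrite r1 andbT; apply: le_lt_trans nr.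
  by rewrite lerD2l lerN2 lef_pV2 ?posrE// ler_nat ltnS leq_maxl.
have rw : unit_disc (r%:C * w).
  rewrite /unit_disc/= normrM norm_real_complex w1 mulr1.
  by rewrite ger0_norm ?(radius_ge0 nr)// ltcR.
rewrite (ev_linear E_functions)// hp//.
apply: lt_le_trans (lerB_normD _ _).
rewrite ltrBrDr (lt_trans (_ : _ < n%:R + C%:R))// ?ltrD2l ?pC//.
rewrite normrM mulrC -ltr_pdivrMr//; apply: lt_trans NC _.
by apply: le_lt_trans fr; rewrite ler_nat leq_maxr.
Qed.

End FunctionSpace.

Unset Implicit Arguments.

Theorem theorem3p1 (R : realType) (E : completeNormedModType R[i])
    (ev : E -> R[i] -> R[i])
    (E_functions : analytic_function_space ev)
    (E_poly : polynomials_dense ev)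
    (E_eval : point_evaluations_continuous ev)
    (E_unbounded : exists f : E,
       circle_measure (radially_unbounded_set (ev f)) = 1%E) :
  residual [set g : E | circle_measure (radially_unbounded_set (ev g)) = 1%E].
Proof.
have ev_an g : analytic_on_disc (ev g) by exact: ev_analytic.
exists [set g : E | circle_measure (radially_unbounded_set (ev g)) = 1%E].
split=> //.
  exists (fun n => [set g : E | ((2 * pi - n.+1%:R^-1)%:E <
      lebesgue_measure (angles `&` large_angles (ev g) n))%E]).
    by move=> n; exact: open_measure_large_angles.
  apply/seteqP; split=> [g /= g1 n _ /=|g gn /=].
    by have /circle_measure_eq1P -> := g1; last exact: ev_an.
  by apply/circle_measure_eq1P => // n; exact: gn.
have [f f1] := E_unbounded.
move=> W W0 oW; have [h [Wh [p hp]]] := E_poly.2 W W0 oW.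
(* As [a] tends to 0, [a *: f + h] tends to the polynomial [h] in the open set [W], so a small
   nonzero [a] stays in [W]; [e / 2] is such a scalar. *)
have [a [a0 Wa]] : exists a : R[i], a != 0 /\ W (a *: f + h).
  have /(_ (0 : R[i]^o)) : continuous (fun a : R[i]^o => a *: f + h).
    move=> a; apply: (@cvgD R[i] E R[i]^o (nbhs a)); last exact: cvg_cst.
    exact: (@cvgZr_tmp R[i] E R[i]^o (nbhs a) _ id a f).
  move=> /(_ W); rewrite scale0r add0r => /(_ (open_nbhs_nbhs (conj oW Wh))).
  move=> /nbhs_ballP[e /= e0 eW]; exists (e / 2); split.
    by rewrite gt_eqF// divr_gt0.
  apply: eW; rewrite -ball_normE/= sub0r normrN gtr0_norm ?divr_gt0//.
  by rewrite ltr_pdivrMr// ltr_pMr// ltr1n.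
exists (a *: f + h); split=> //=; apply: circle_measure_eq1S f1.
- exact: ev_analytic.
- exact: ev_analytic.
- exact: radially_unbounded_add_poly hp.
Qed.
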